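(* Let $\bm{U}_{\rm s}\in\mathbb{C}^{M\times M}$ be the unitary eigenvector matrix of $\bm{R}=\bm{U}_{\rm s}\,\mathrm{diag}(\lambda_1,\dots,\lambda_M)\bm{U}_{\rm s}^{H}$, let $\bm{D}_{\rm s}^\star$ be the water-filling matrix defined in the context, and let $\mathsf{X}^\star=\sqrt{T}\,\bm{U}_{\rm s}\bm{D}_{\rm s}^\star\mathsf{Q}$, where $\mathsf{Q}$ is an $M\times T$ isotropically distributed semi-unitary random matrix independent of the communication channel $\mathsf{H}_{\rm c}$. Then $$\mathsf{H}_{\rm c}\mathsf{X}^\star\overset{d}{=}\sqrt{T}\,\mathsf{H}_{\rm c}\bm{D}_{\rm s}^\star\mathsf{Q},$$ and the unitary factor $\bm{U}_{\rm s}$ does not affect the communication rate: with $\mathsf{X}_{\rm eff}^\star=\sqrt{T}\,\bm{D}_{\rm s}^\star\mathsf{Q}$, $$I(\mathsf{X}^\star;\mathsf{H}_{\rm c}\mathsf{X}^\star+\mathsf{Z}_{\rm c})=I(\mathsf{X}_{\rm eff}^\star;\mathsf{H}_{\rm c}\mathsf{X}_{\rm eff}^\star+\mathsf{Z}_{\rm c}).$$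
   Context: $T\ge M$ and $N_{\rm c},N_{\rm s}$ are positive integers. $\mathsf{H}_{\rm c}\in\mathbb{C}^{N_{\rm c}\times M}$ has i.i.d. $\mathcal{CN}(0,1)$ entries, $\mathsf{Z}_{\rm c}\in\mathbb{C}^{N_{\rm c}\times T}$ has i.i.d. $\mathcal{CN}(0,\sigma_{\rm c}^2)$ entries with $\sigma_{\rm c}^2>0$, and $\mathsf{H}_{\rm c}$, $\mathsf{Z}_{\rm c}$, $\mathsf{Q}$ are mutually independent. $\mathsf{Q}$ semi-unitary means $\mathsf{Q}\mathsf{Q}^{H}=\bm{I}_M$; isotropically distributed means $\mathsf{Q}\bm{V}$ has the same distribution as $\mathsf{Q}$ for every deterministic $T\times T$ unitary $\bm{V}$. $\bm{R}\in\mathbb{C}^{M\times M}$ is a given Hermitian positive definite matrix (the correlation matrix $\mathbb{E}[\mathsf{H}_{\rm s}^{H}\mathsf{H}_{\rm s}]$ of the sensing channel) with eigenvalues $\lambda_1,\dots,\lambda_M>0$, $\kappa=1/(\sigma_{\rm s}^2N_{\rm s})$ with $\sigma_{\rm s}^2>0$, and $\bm{D}_{\rm s}^\star=\mathrm{diag}(d_1^\star,\dots,d_M^\star)$ with $d_i^\star\ge0$, $(d_i^\star)^2=\frac{1}{\kappa T}(\nu-\lambda_i^{-1})^+$, where $\nu\ge 0$ is chosen so that $\sum_i (d_i^\star)^2=M$. $I(\cdot;\cdot)$ is mutual information and $\overset{d}{=}$ is equality in distribution. *)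

(* Defs.v *)
From HB Require Import structures.
From mathcomp Require Import all_boot all_order all_algebra.
From mathcomp Require Import complex.
From mathcomp Require Import all_classical all_reals all_analysis.

Set Implicit Arguments.
Unset Strict Implicit.
Unset Printing Implicit Defensive.

Import Order.TTheory GRing.Theory Num.Theory.

Local Open Scope classical_set_scope.
Local Open Scope ring_scope.
Local Open Scope complex_scope.
Local Open Scope sesquilinear_scope.

Section measurable_complex.
Variable R : realType.

Definition complex_pair (z : R[i]) : R * R := (complex.Re z, complex.Im z).

HB.instance Definition _ := isPointed.Build R[i] (0 : R[i]).

(* The Borel sets of R[i]: the preimages of the Borel sets of R^2 under
   x + iy |-> (x, y). *)
HB.instance Definition _ :=
  @isMeasurable.Build (preimage_display complex_pair) R[i]
    (g_sigma_algebra_preimage complex_pair)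
    (@measurable0 _ (g_sigma_algebra_preimageType complex_pair))
    (@measurableC _ (g_sigma_algebra_preimageType complex_pair))
    (@bigcupT_measurable _ (g_sigma_algebra_preimageType complex_pair)).

Lemma measurable_fun_complexP d (T : measurableType d) (f : T -> R[i]) :
  measurable_fun setT f <->
  measurable_fun setT (fun x => complex.Re (f x)) /\
  measurable_fun setT (fun x => complex.Im (f x)).
Proof.
have mpair : measurable_fun setT f <-> measurable_fun setT (complex_pair \o f).
  split=> mf _ B mB; last first.
    by case: mB => C mC <-; rewrite setTI; exact: mf.
  rewrite comp_preimage; apply: mf => //.
  by exists B => //; rewrite setTI.
by rewrite mpair; exact: measurable_fun_pairP.
Qed.

Lemma measurable_complexD d (T : measurableType d) (f g : T -> R[i]) :
  measurable_fun setT f -> measurable_fun setT g ->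
  measurable_fun setT (fun x => f x + g x).
Proof.
move=> /measurable_fun_complexP[fr fi] /measurable_fun_complexP[gr gi].
apply/measurable_fun_complexP; split.
- apply: (eq_measurable_fun (fun x => complex.Re (f x) + complex.Re (g x))).
    by move=> x _; case: (f x) (g x) => [? ?] [? ?].
  exact: measurable_realfun.measurable_funD.
- apply: (eq_measurable_fun (fun x => complex.Im (f x) + complex.Im (g x))).
    by move=> x _; case: (f x) (g x) => [? ?] [? ?].
  exact: measurable_realfun.measurable_funD.
Qed.

Lemma measurable_complexM d (T : measurableType d) (f g : T -> R[i]) :
  measurable_fun setT f -> measurable_fun setT g ->
  measurable_fun setT (fun x => f x * g x).
Proof.
move=> /measurable_fun_complexP[fr fi] /measurable_fun_complexP[gr gi].
apply/measurable_fun_complexP; split.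
- apply: (eq_measurable_fun (fun x => complex.Re (f x) * complex.Re (g x)
      - complex.Im (f x) * complex.Im (g x))).
    by move=> x _; case: (f x) (g x) => [? ?] [? ?].
  by apply: measurable_realfun.measurable_funB; exact: measurable_realfun.measurable_funM.
- apply: (eq_measurable_fun (fun x => complex.Re (f x) * complex.Im (g x)
      + complex.Im (f x) * complex.Re (g x))).
    by move=> x _; case: (f x) (g x) => [? ?] [? ?].
  by apply: measurable_realfun.measurable_funD; exact: measurable_realfun.measurable_funM.
Qed.

End measurable_complex.

(* An alias of the matrix type: it carries the Borel sigma-algebra below without
   adding a canonical instance to the matrix type itself. *)
Definition cmatrix (R : realType) (m n : nat) : Type := 'M[R[i]]_(m, n).

Section measurable_cmatrix.
Variables (R : realType) (m n : nat).

HB.instance Definition _ := Choice.on (cmatrix R m n).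
HB.instance Definition _ :=
  isPointed.Build (cmatrix R m n) (0 : 'M[R[i]]_(m, n)).

Definition cmatrix_entry (i : 'I_m) (j : 'I_n) (A : cmatrix R m n) : R[i] :=
  (A : 'M[R[i]]_(m, n)) i j.

Definition cmatrix_cylinders : set (set (cmatrix R m n)) :=
  [set A | exists i j, preimage_set_system setT (cmatrix_entry i j) measurable A].

(* The sigma-algebra generated by the entries, i.e. the Borel sets of
   C^(m x n). *)
HB.instance Definition _ :=
  @isMeasurable.Build (sigma_display cmatrix_cylinders) (cmatrix R m n)
    <<s cmatrix_cylinders >>
    (@sigma_algebra0 _ setT cmatrix_cylinders)
    (@sigma_algebraC _ cmatrix_cylinders)
    (@sigma_algebra_bigcup _ setT cmatrix_cylinders).

Lemma measurable_fun_cmatrixP d (T : measurableType d) (f : T -> cmatrix R m n) :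
  measurable_fun setT f <->
  forall i j, measurable_fun setT (cmatrix_entry i j \o f).
Proof.
split=> [mf i j _ B mB|mf].
  rewrite comp_preimage; apply: mf => //.
  by apply: sub_sigma_algebra; exists i, j, B => //; rewrite setTI.
apply: (measurability cmatrix_cylinders) => //.
move=> _ [_ [i [j [B mB <-]]] <-]; rewrite setTI -comp_preimage.
exact: mf.
Qed.

End measurable_cmatrix.

Section random_matrices.
Context d (Omega : measurableType d) (R : realType).

Definition rmx_mul m n p (X : {mfun Omega >-> cmatrix R m n})
    (Y : {mfun Omega >-> cmatrix R n p}) (w : Omega) : cmatrix R m p :=
  X w *m Y w.

Definition rmx_add m n (X Y : {mfun Omega >-> cmatrix R m n}) (w : Omega) :
    cmatrix R m n :=
  (X w : 'M[R[i]]_(m, n)) + (Y w : 'M[R[i]]_(m, n)).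

Definition rmx_scale m n (c : R[i]) (X : {mfun Omega >-> cmatrix R m n})
    (w : Omega) : cmatrix R m n :=
  c *: (X w : 'M[R[i]]_(m, n)).

Definition rmx_cst m n (A : 'M[R[i]]_(m, n)) (w : Omega) : cmatrix R m n := A.

Lemma measurable_rmx_mul m n p (X : {mfun Omega >-> cmatrix R m n})
    (Y : {mfun Omega >-> cmatrix R n p}) : measurable_fun setT (rmx_mul X Y).
Proof.
have mX := (measurable_fun_cmatrixP X).1 (measurable_funPT X).
have mY := (measurable_fun_cmatrixP Y).1 (measurable_funPT Y).
apply/measurable_fun_cmatrixP => i j.
apply: (eq_measurable_fun (fun w =>
    \sum_(k < n) cmatrix_entry i k (X w) * cmatrix_entry k j (Y w))).
  by move=> w _; rewrite /= /cmatrix_entry mxE.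
elim: (index_enum _) => [|k s IHs].
  apply: (eq_measurable_fun (cst (0 : R[i]))) => [w _|]; first by rewrite big_nil.
  exact: measurable_cst.
apply: (eq_measurable_fun (fun w =>
    cmatrix_entry i k (X w) * cmatrix_entry k j (Y w) +
    \sum_(k <- s) cmatrix_entry i k (X w) * cmatrix_entry k j (Y w))).
  by move=> w _; rewrite big_cons.
apply: measurable_complexD => //.
by apply: measurable_complexM; [exact: mX | exact: mY].
Qed.

Lemma measurable_rmx_add m n (X Y : {mfun Omega >-> cmatrix R m n}) :
  measurable_fun setT (rmx_add X Y).
Proof.
have mX := (measurable_fun_cmatrixP X).1 (measurable_funPT X).
have mY := (measurable_fun_cmatrixP Y).1 (measurable_funPT Y).
apply/measurable_fun_cmatrixP => i j.
apply: (eq_measurable_fun (fun w =>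
    cmatrix_entry i j (X w) + cmatrix_entry i j (Y w))).
  by move=> w _; rewrite /= /cmatrix_entry mxE.
by apply: measurable_complexD; [exact: mX | exact: mY].
Qed.

Lemma measurable_rmx_scale m n c (X : {mfun Omega >-> cmatrix R m n}) :
  measurable_fun setT (rmx_scale c X).
Proof.
have mX := (measurable_fun_cmatrixP X).1 (measurable_funPT X).
apply/measurable_fun_cmatrixP => i j.
apply: (eq_measurable_fun (fun w => c * cmatrix_entry i j (X w))).
  by move=> w _; rewrite /= /cmatrix_entry mxE.
by apply: measurable_complexM; [exact: measurable_cst | exact: mX].
Qed.

Lemma measurable_rmx_cst m n (A : 'M[R[i]]_(m, n)) :
  measurable_fun setT (rmx_cst A : Omega -> cmatrix R m n).
Proof. exact: measurable_cst. Qed.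

HB.instance Definition _ m n p (X : {mfun Omega >-> cmatrix R m n})
    (Y : {mfun Omega >-> cmatrix R n p}) :=
  isMeasurableFun.Build _ _ _ _ (rmx_mul X Y) (measurable_rmx_mul X Y).

HB.instance Definition _ m n (X Y : {mfun Omega >-> cmatrix R m n}) :=
  isMeasurableFun.Build _ _ _ _ (rmx_add X Y) (measurable_rmx_add X Y).

HB.instance Definition _ m n c (X : {mfun Omega >-> cmatrix R m n}) :=
  isMeasurableFun.Build _ _ _ _ (rmx_scale c X) (measurable_rmx_scale c X).

HB.instance Definition _ m n (A : 'M[R[i]]_(m, n)) :=
  isMeasurableFun.Build _ _ _ _ (rmx_cst A) (measurable_rmx_cst A).

End random_matrices.

Arguments rmx_cst {d Omega R m n} A w.

Section random_elements.
Context d (Omega : measurableType d) (R : realType) (P : probability Omega R).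

Definition eq_distribution d' (S : measurableType d') (X Y : {RV P >-> S}) :=
  forall A : set S, measurable A -> distribution P X A = distribution P Y A.

(* Independence of a finite family of sigma-algebras; random elements are
   independent when the sigma-algebras that they generate are. *)
Definition mutually_independent (I : finType) (F : I -> set (set Omega)) :=
  forall (J : {set I}) (A : I -> set Omega),
    (forall i, i \in J -> F i (A i)) ->
    P (\bigcap_(i in [set j | j \in J]) A i) = (\prod_(i in J) P (A i))%E.

Definition rv_pair d1 d2 (S1 : measurableType d1) (S2 : measurableType d2)
    (X : {RV P >-> S1}) (Y : {RV P >-> S2}) (w : Omega) : S1 * S2 :=
  (X w, Y w).

HB.instance Definition _ d1 d2 (S1 : measurableType d1)
    (S2 : measurableType d2) (X : {RV P >-> S1}) (Y : {RV P >-> S2}) :=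
  isMeasurableFun.Build _ _ _ _ (rv_pair X Y)
    (measurable_fun_pair (measurable_funPT X) (measurable_funPT Y)).

(* CN(0, v), v > 0: independent real and imaginary parts, each N(0, v / 2).
   The second argument of normal_prob is the standard deviation. *)
Definition complex_normal (v : R) : set R[i] -> \bar R :=
  let s := Num.sqrt (v / 2) in
  pushforward (normal_prob 0 s \x normal_prob 0 s)%E
    (fun p : R * R => p.1 +i* p.2).

Definition iid_complex_normal m n (X : {RV P >-> cmatrix R m n}) (v : R) :=
  (forall i j (A : set R[i]), measurable A ->
     pushforward P (cmatrix_entry i j \o X) A = complex_normal v A) /\
  mutually_independent (fun ij : 'I_m * 'I_n =>
    g_sigma_algebra_preimage (cmatrix_entry ij.1 ij.2 \o X)).

(* As a random matrix, Q is only required to satisfy Q Q^H = I almost surely;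
   unitarymx is the predicate Q Q^H = I, also for rectangular matrices. *)
Definition semi_unitary m n (Q : {RV P >-> cmatrix R m n}) :=
  {ae P, forall w, (Q w : 'M[R[i]]_(m, n)) \is unitarymx}.

Definition isotropic m n (Q : {RV P >-> cmatrix R m n}) :=
  forall V : 'M[R[i]]_n, V \is unitarymx ->
    eq_distribution (rmx_mul Q (rmx_cst V)) Q.

End random_elements.

(* P is not recoverable from the type {RV P >-> S}, which unfolds to
   {mfun _ >-> S}. *)
Arguments eq_distribution {d Omega R} P {d' S} X Y.
Arguments rv_pair {d Omega R} P {d1 d2 S1 S2} X Y w.
Arguments iid_complex_normal {d Omega R} P {m n} X v.
Arguments semi_unitary {d Omega R} P {m n} Q.
Arguments isotropic {d Omega R} P {m n} Q.

(* The relative entropy D(p || q) = E_p[ln (dp/dq)], in nats. The integrand has a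
   p-integrable negative part, so the integral is well defined in [0, +oo]; the
   points where the chosen version of dp/dq is <= 0 are p-negligible. *)
Definition KL_divergence d (S : measurableType d) (R : realType)
    (p q : probability S R) : \bar R :=
  if `[< p `<< q >] then
    (\int[p]_x lne (Radon_Nikodym (charge_of_finite_measure p) q x))%E
  else +oo%E.

(* I(X; Y) = D(P_(X,Y) || P_X (x) P_Y). *)
Definition mutual_information d (Omega : measurableType d) (R : realType)
    (P : probability Omega R) d1 d2 (S1 : measurableType d1)
    (S2 : measurableType d2) (X : {RV P >-> S1}) (Y : {RV P >-> S2}) : \bar R :=
  KL_divergence (distribution P (rv_pair P X Y))
    (distribution P X \x distribution P Y)%E.

Arguments mutual_information {d Omega R} P {d1 d2 S1 S2} X Y.

Definition posdefmx (R : realType) n (A : 'M[R[i]]_n) :=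
  A \is hermsymmx /\
  forall x : 'cV[R[i]]_n, x != 0 -> 0 < (x ^t* *m A *m x) 0 0.

Definition real_diag_mx (R : realType) n (a : 'I_n -> R) : 'M[R[i]]_n :=
  diag_mx (\row_i (a i)%:C).

(* Main.v *)
(* Right multiplication by a unitary matrix preserves the law of a matrix with
   i.i.d. circular complex Gaussian entries; since Hc is independent of (Zc, Q),
   the triples (Hc Us, Zc, Q) and (Hc, Zc, Q) have the same law, which gives the
   equality in distribution.  It also shows that (Xs, Ys) has the law of
   (Us Xeff, Yeff), and a relative entropy is unchanged when both measures are
   pushed forward along a measurable map with a measurable left inverse.

   The Gaussian invariance comes down to plane rotations: a rotation with cosine
   c >= 0 is a product of three shears, each of which preserves Lebesgue measure
   by Tonelli's theorem, and the density depends on x^2 + y^2 only.  Givens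
   elimination reduces a real orthogonal matrix to a diagonal one with entries
   1 or -1 by such rotations, and a unitary matrix acts on real and imaginary
   parts as a real orthogonal matrix. *)
From HB Require Import structures.
Require Import Defs.
From mathcomp Require Import all_boot all_order all_algebra.
From mathcomp Require Import complex.
From mathcomp Require Import all_classical all_reals all_analysis.
From mathcomp Require Import measurable_realfun.
From mathcomp Require Import ring.

Set Implicit Arguments.
Unset Strict Implicit.
Unset Printing Implicit Defensive.

Import Order.TTheory GRing.Theory Num.Theory.

Local Open Scope classical_set_scope.
Local Open Scope ring_scope.
Local Open Scope complex_scope.
Local Open Scope sesquilinear_scope.

(** * Shears and rotations preserve planar Lebesgue integrals *)

Section lebesgue_shear.
Context (R : realType).
Local Notation mu := (@lebesgue_measure R).
Local Notation RR := (measurableTypeR R).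

(** Lebesgue measure is determined by its values on half-open intervals, and a translation carries
    such an interval to one of the same length. *)
Lemma lebesgue_measureD (a : R) (A : set R) : measurable A ->
  pushforward mu ((fun x => x + a) : RR -> RR) A = mu A.
Proof.
move=> mA; have ma : measurable_fun setT ((fun x => x + a) : RR -> RR).
  exact: measurable_funD.
pose ma_mixin := isMeasurableFun.Build _ _ _ _ _ ma.
pose ma_pack : {mfun RR >-> RR} := HB.pack ((fun x => x + a) : RR -> RR) ma_mixin.
apply/esym; apply: (lebesgue_measure_unique (mu := pushforward mu ma_pack)) => //.
move=> _ [[x y]] _ <-; transitivity (mu `]x - a, y - a]%classic); last first.
  congr (mu _); apply/seteqP.
  by split=> z /=; rewrite !in_itv/= ltrBlDr lerBrDr.
rewrite !lebesgue_measure_itv/= !lte_fin ltrD2r; case: ifP => // _.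
by rewrite -!EFinB; congr EFin; ring.
Qed.

Lemma ge0_integral_translate (f : R -> \bar R) (a : R) :
  measurable_fun setT f -> (forall x, 0 <= f x)%E ->
  (\int[mu]_x f (x + a)%R = \int[mu]_x f x)%E.
Proof.
move=> mf f0; have ma : measurable_fun setT ((fun x => x + a) : RR -> RR).
  exact: measurable_funD.
rewrite [RHS](eq_measure_integral
    (pushforward mu ((fun x => x + a) : RR -> RR))); last first.
  by move=> A mA _; apply/esym; exact: lebesgue_measureD.
by rewrite (ge0_integral_pushforward ma).
Qed.

Let shear1 (t : R) (z : R * R) := (z.1 + t * z.2, z.2).
Let shear2 (t : R) (z : R * R) := (z.1, z.2 + t * z.1).

(** Tonelli's theorem makes [x] the inner variable; for fixed [y] the shear is then a translation by
    [t * y]. *)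
Lemma ge0_integral_shear1 (f : R * R -> \bar R) (t : R) :
  measurable_fun setT f -> (forall x, 0 <= f x)%E ->
  (\int[mu]_x \int[mu]_y f (x + t * y, y)%R = \int[mu]_x \int[mu]_y f (x, y))%E.
Proof.
move=> mf f0.
have mfs : measurable_fun setT (fun z => f (shear1 t z)).
  apply: measurableT_comp => //; apply: measurable_fun_pair => //.
  by apply: measurable_funD => //; apply: measurable_funM.
apply: etrans (fubini_tonelli (m1 := mu) (m2 := mu) _ mfs (fun=> f0 _)) _.
apply: etrans (esym (fubini_tonelli (m1 := mu) (m2 := mu) _ mf f0)).
apply: eq_integral => y _ /=.
apply: (ge0_integral_translate (f := fun x => f (x, y)) (t * y)%R) => //.
by apply: measurableT_comp => //; apply: measurable_fun_pair.
Qed.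

Lemma ge0_integral_shear2 (f : R * R -> \bar R) (t : R) :
  measurable_fun setT f -> (forall x, 0 <= f x)%E ->
  (\int[mu]_x \int[mu]_y f (x, y + t * x)%R = \int[mu]_x \int[mu]_y f (x, y))%E.
Proof.
move=> mf f0; apply: eq_integral => x _.
apply: (ge0_integral_translate (f := fun y => f (x, y)) (t * x)%R) => //.
by apply: measurableT_comp => //; apply: measurable_fun_pair.
Qed.

Lemma ge0_integral_rotation (f : R * R -> \bar R) (c s : R) :
  measurable_fun setT f -> (forall x, 0 <= f x)%E ->
  0 <= c -> c ^+ 2 + s ^+ 2 = 1 ->
  (\int[mu]_x \int[mu]_y f (c * x + s * y, c * y - s * x)%R
   = \int[mu]_x \int[mu]_y f (x, y))%E.
Proof.
(* The half-angle tangent [t] satisfies [t * (1 + c) = s] and [t * s = 1 - c], which is what makes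
   the shears with parameters [t], [- s], [t] compose to the rotation. The hypothesis [0 <= c] keeps
   [1 + c] nonzero. *)
move=> mf f0 c0 cs1; pose t := s / (1 + c).
have c1 : 1 + c != 0 by rewrite gt_eqF// ltr_wpDr.
have t1 : t * (1 + c) = s by rewrite /t divfK.
have ts : t * s = 1 - c.
  rewrite /t mulrAC -expr2; apply: (mulIf c1); rewrite divfK//.
  by transitivity (1 - c ^+ 2); [rewrite -cs1; ring | ring].
have mshear1 (g : R * R -> \bar R) u : measurable_fun setT g ->
    measurable_fun setT (fun z => g (shear1 u z)).
  move=> mg; apply: measurableT_comp => //; apply: measurable_fun_pair => //.
  by apply: measurable_funD => //; apply: measurable_funM.
have mshear2 (g : R * R -> \bar R) u : measurable_fun setT g ->
    measurable_fun setT (fun z => g (shear2 u z)).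
  move=> mg; apply: measurableT_comp => //; apply: measurable_fun_pair => //.
  by apply: measurable_funD => //; apply: measurable_funM.
pose g2 z := f (shear1 t z); pose g1 z := g2 (shear2 (- s) z).
have mg2 : measurable_fun setT g2 by exact: mshear1.
have mg1 : measurable_fun setT g1 by exact: mshear2.
transitivity (\int[mu]_x \int[mu]_y g1 (x + t * y, y)%R)%E.
  apply: eq_integral => x _; apply: eq_integral => y _.
  rewrite /g1 /g2 /shear1 /shear2 /=; congr f; congr pair.
    transitivity ((1 - t * s) * x + t * (1 + (1 - t * s)) * y); last by ring.
    by rewrite ts opprB addrCA subrr addr0 t1.
  transitivity ((1 - t * s) * y - s * x); last by ring.
  by rewrite ts opprB addrCA subrr addr0.
apply: etrans (ge0_integral_shear1 t mg1 (fun=> f0 _)) _.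
transitivity (\int[mu]_x \int[mu]_y g2 (x, y))%E.
  by apply: (ge0_integral_shear2 (f := g2)) => // ?; exact: f0.
exact: ge0_integral_shear1.
Qed.

End lebesgue_shear.

(** * Rotation and sign invariance of centred normal laws *)

Section normal_rotation.
Context (R : realType).
Local Notation mu := (@lebesgue_measure R).

(** By uniqueness of densities, [normal_pdf] agrees almost everywhere with the Radon-Nikodym
    derivative for which the change of variables holds. *)
Lemma ge0_integral_normal_prob (m sigma : R) (f : R -> \bar R) :
  measurable_fun setT f -> (forall x, 0 <= f x)%E ->
  (\int[normal_prob m sigma]_x f x = \int[mu]_x (f x * (normal_pdf m sigma x)%:E))%E.
Proof.
move=> mf f0.
have dom := normal_prob_dominates m sigma.
have mpdf : measurable_fun setT (fun x : R => (normal_pdf m sigma x)%:E).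
  by apply/measurable_EFinP; exact: measurable_normal_pdf.
rewrite -(Radon_Nikodym_SigmaFinite.change_of_variables dom)//.
set g := Radon_Nikodym_SigmaFinite.f _ _.
have ig : mu.-integrable setT g by exact: Radon_Nikodym_SigmaFinite.f_integrable.
have gE : ae_eq mu setT g (fun x => (normal_pdf m sigma x)%:E).
  apply: integral_ae_eq => // E _ mE.
  by rewrite -Radon_Nikodym_SigmaFinite.f_integral.
apply: ae_eq_integral => //.
- by apply: emeasurable_funM => //; exact: measurable_int ig.
- exact: emeasurable_funM.
- by apply: filterS gE => x /= + _ => ->.
Qed.

(** Brings the product law to an iterated Lebesgue integral, the form in which a rotation can act;
    the indicator as a factor keeps the domain of integration fixed. *)
Lemma product_normal_probE (sigma : R) (A : set (R * R)) : measurable A ->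
  ((normal_prob 0 sigma \x normal_prob 0 sigma) A =
  \int[mu]_x \int[mu]_y
    ((\1_A (x, y))%:E * (normal_pdf 0 sigma x * normal_pdf 0 sigma y)%:E))%E.
Proof.
move=> mA; pose g := normal_pdf 0 sigma.
have mg : measurable_fun setT (fun x : R => (g x)%:E).
  by apply/measurable_EFinP; exact: measurable_normal_pdf.
have g0 x : 0 <= g x by exact: normal_pdf_ge0.
rewrite [LHS]/product_measure1 ge0_integral_normal_prob//; last first.
  exact: measurable_fun_xsection.
apply: eq_integral => x _.
have mAx := measurable_xsection x mA.
rewrite [X in (X * _)%E]/= [X in (X * _)%E]/normal_prob.
rewrite -ge0_integralZr//; last 3 first.
- exact: measurable_funTS.
- by move=> y _; rewrite lee_fin.
- by rewrite lee_fin.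
rewrite integral_mkcond; apply: eq_integral => y _.
rewrite patchE /= mem_xsection indicE; case: (_ \in A) => /=.
  by rewrite mul1e -EFinM mulrC.
by rewrite mul0e.
Qed.

Lemma normal_pdfM_rotation (sigma c s x y : R) : sigma != 0 ->
  c ^+ 2 + s ^+ 2 = 1 ->
  normal_pdf 0 sigma (c * x + s * y) * normal_pdf 0 sigma (c * y - s * x) =
  normal_pdf 0 sigma x * normal_pdf 0 sigma y.
Proof.
move=> s0 cs1; rewrite !normal_pdfE// mulrACA [RHS]mulrACA -!expRD !subr0.
congr (_ * expR _); rewrite -!mulrDl; congr (_ / _).
rewrite -!opprD; congr (- _).
transitivity ((c ^+ 2 + s ^+ 2) * (x ^+ 2 + y ^+ 2)); first by ring.
by rewrite cs1 mul1r.
Qed.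

Lemma product_normal_prob_rotation (sigma c s : R) (A : set (R * R)) :
  sigma != 0 -> 0 <= c -> c ^+ 2 + s ^+ 2 = 1 -> measurable A ->
  ((normal_prob 0 sigma \x normal_prob 0 sigma)
    [set z | A (c * z.1 + s * z.2, c * z.2 - s * z.1)%R] =
   (normal_prob 0 sigma \x normal_prob 0 sigma) A)%E.
Proof.
move=> s0 c0 cs1 mA.
pose rot (z : R * R) := (c * z.1 + s * z.2, c * z.2 - s * z.1).
have mrot : measurable_fun setT rot.
  apply: measurable_fun_pair => //.
    by apply: measurable_funD; apply: measurable_funM.
  by apply: measurable_funB; apply: measurable_funM.
have mrotA : measurable (rot @^-1` A).
  by rewrite -[X in measurable X]setTI; exact: mrot.
apply: etrans (product_normal_probE _ mrotA) _.
apply: etrans _ (esym (product_normal_probE _ mA)).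
pose F (z : R * R) :=
  ((\1_A z)%:E * (normal_pdf 0 sigma z.1 * normal_pdf 0 sigma z.2)%:E)%E.
have mF : measurable_fun setT F.
  apply: emeasurable_funM.
    by apply/measurable_EFinP; exact: measurable_indic.
  apply/measurable_EFinP; apply: measurable_funM.
    by apply: measurableT_comp => //; exact: measurable_normal_pdf.
  by apply: measurableT_comp => //; exact: measurable_normal_pdf.
have F0 z : (0 <= F z)%E.
  apply: mule_ge0; rewrite lee_fin//.
  by apply: mulr_ge0; exact: normal_pdf_ge0.
(* Composing [F] with the rotation turns the indicator of [A] into that of its preimage and leaves
   the density unchanged. *)
apply: etrans (ge0_integral_rotation mF F0 c0 cs1).
apply: eq_integral => x _; apply: eq_integral => y _.
by rewrite /F /= normal_pdfM_rotation.
Qed.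

(** The centred density is even and Lebesgue measure is invariant under [-%R]. This serves the
    diagonal entries equal to [-1] that remain after elimination. *)
Lemma normal_probN (sigma : R) (A : set R) : sigma != 0 -> measurable A ->
  normal_prob 0 sigma [set x | A (- x)] = normal_prob 0 sigma A.
Proof.
move=> s0 mA; pose RR := measurableTypeR R.
have mN : measurable_fun setT (-%R : RR -> RR) by exact: oppr_measurable.
have mpdf : measurable_fun setT (fun x : R => (normal_pdf 0 sigma x)%:E).
  by apply/measurable_EFinP; exact: measurable_normal_pdf.
rewrite /normal_prob [RHS](eq_measure_integral
    (pushforward mu (-%R : RR -> RR))); last first.
  by move=> B mB _; apply/esym; exact: lebesgue_measureN.
apply: etrans (esym (ge0_integral_pushforward mN mu mA (measurable_funTS mpdf) _)).
  apply: eq_integral => x _ /=.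
  by rewrite !normal_pdfE// /normal_fun !subr0 sqrrN.
by move=> x _; rewrite lee_fin normal_pdf_ge0.
Qed.

End normal_rotation.

(** Yields the pushforward as a bundled measure, the form that uniqueness theorems for measures
    take. *)
Lemma exists_pushforward_measure d d' (S : measurableType d)
    (S' : measurableType d') (R : realType) (m : {measure set S -> \bar R})
    (f : S -> S') : measurable_fun setT f ->
  exists mu : {measure set S' -> \bar R}, forall A, mu A = m (f @^-1` A).
Proof. by move=> mf; unshelve eexists (pushforward m f). Qed.

(** The constant is absorbed into the first factor, after which uniqueness of the product measure
    applies. Below, [k] is the probability carried by the coordinates that a rotation leaves
    fixed. *)
Lemma mscale_product_measure_unique d1 d2 (T1 : measurableType d1)
    (T2 : measurableType d2) (R : realType) (m1 : {finite_measure set T1 -> \bar R})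
    (m2 : {finite_measure set T2 -> \bar R}) (k : {nonneg R})
    (mu : {measure set (T1 * T2) -> \bar R}) :
  (forall A B, measurable A -> measurable B ->
    mu (A `*` B) = (k%:num%:E * m1 A * m2 B)%E) ->
  forall X, measurable X -> mu X = (k%:num%:E * (m1 \x m2) X)%E.
Proof.
move=> muE X mX.
rewrite -(product_measure_unique (m1 := mscale k m1) (m2 := m2) muE mX).
apply: etrans (ge0_integral_mscale m1 measurableT k _ _) _ => //.
exact: measurable_fun_xsection.
Qed.

(** * Plane rotations and orthogonal families of rows *)

Section plane_rotation.
Context (R : realType) (I : finType).
Implicit Types (x y : I -> R) (i k l : I).

Definition plane_rotation i k (c s : R) x l : R :=
  if l == i then c * x i + s * x k else
  if l == k then c * x k - s * x i else x l.

(** This serves twice: rotated rows stay orthonormal, and a rotation of the sample is compensated by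
    the same rotation of the rows. *)
Lemma plane_rotation_dot i k (c s : R) x y : i != k -> c ^+ 2 + s ^+ 2 = 1 ->
  \sum_l plane_rotation i k c s x l * plane_rotation i k c s y l =
  \sum_l x l * y l.
Proof.
move=> ik cs1.
rewrite (bigD1 i)//= (bigD1 k) 1?eq_sym//= [RHS](bigD1 i)//=.
rewrite [in RHS](bigD1 k) 1?eq_sym//= !addrA; congr (_ + _); last first.
  by apply: eq_bigr => l /andP[li lk]; rewrite /plane_rotation (negbTE li) (negbTE lk).
rewrite /plane_rotation !eqxx eq_sym (negbTE ik).
transitivity ((c ^+ 2 + s ^+ 2) * (x i * y i + x k * y k)); first by ring.
by rewrite cs1 mul1r.
Qed.

Definition orthogonal_family (a : I -> I -> R) :=
  forall i j, \sum_k a i k * a j k = (i == j)%:R.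

Definition diagonal_row (a : I -> I -> R) i :=
  [forall k, (k != i) ==> (a i k == 0)].

Lemma diagonal_rowP a i :
  reflect (forall k, k != i -> a i k = 0) (diagonal_row a i).
Proof.
by apply: (iffP 'forall_implyP) => h k /h => [/eqP|->].
Qed.

Lemma diagonal_row_sqr a i : orthogonal_family a -> diagonal_row a i ->
  a i i ^+ 2 = 1.
Proof.
move=> /(_ i i) + /diagonal_rowP di; rewrite eqxx (bigD1 i)//= big1 ?addr0.
  by rewrite expr2.
by move=> k ki; rewrite di// mul0r.
Qed.

(** Row [i] is plus or minus a unit vector, so its orthogonality to row [j] reduces to
    [a j i * a i i = 0]. *)
Lemma diagonal_row_column a i j : orthogonal_family a -> diagonal_row a i ->
  j != i -> a j i = 0.
Proof.
move=> oa di ji; have := oa j i; rewrite (negbTE ji) (bigD1 i)//= big1 ?addr0.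
  move/eqP; rewrite mulf_eq0 => /orP[/eqP//|/eqP aii0].
  have := diagonal_row_sqr oa di.
  by rewrite aii0 expr0n/= => /esym/eqP; rewrite oner_eq0.
by move=> k ki; move/diagonal_rowP : di => ->//; rewrite mulr0.
Qed.

End plane_rotation.

(** * Orthogonal invariance of i.i.d. real normal families *)

Section iid_normal.
Context d (Omega : measurableType d) (R : realType) (P : probability Omega R).
Variables (I : finType) (sigma : R).
Hypothesis sigma_neq0 : sigma != 0.
Local Notation gauss := (normal_prob 0 sigma).

(** One product formula encodes both independence and marginal laws: taking [setT] for some of the
    [B i] recovers every subfamily. *)
Definition iid_normal (X : I -> Omega -> R) :=
  (forall i, measurable_fun setT (X i)) /\
  forall B : I -> set R, (forall i, measurable (B i)) ->
    P [set w | forall i, B i (X i w)] = (\prod_i gauss (B i))%E.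

Lemma measurable_forall (Q : pred I) (X : I -> Omega -> R) (B : I -> set R) :
  (forall i, measurable_fun setT (X i)) -> (forall i, measurable (B i)) ->
  measurable [set w | forall i, Q i -> B i (X i w)].
Proof.
move=> mX mB.
have -> : [set w | forall i, Q i -> B i (X i w)] =
    \bigcap_(i in [set i | Q i]) (X i @^-1` B i) by [].
apply: fin_bigcap_measurable => // i _.
by rewrite -[X in measurable X]setTI; exact: mX.
Qed.

Lemma measurable_plane_rotation (X : I -> Omega -> R) i k c s :
  (forall i, measurable_fun setT (X i)) ->
  forall l, measurable_fun setT (fun w => plane_rotation i k c s (X ^~ w) l).
Proof.
move=> mX l; rewrite /plane_rotation; case: (l == i).
  by apply: measurable_funD; apply: measurable_funM.
case: (l == k) => //.
by apply: measurable_funB; apply: measurable_funM.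
Qed.

(** With the other coordinates confined to their sets, the pair [(X i, X k)] induces a finite
    measure that is a constant times the product normal law on rectangles, hence on all measurable
    sets. Rotation invariance of that law is then applied to the preimage of a rectangle, which need
    not be a rectangle. *)
Lemma iid_normal_plane_rotation (X : I -> Omega -> R) i k c s : i != k ->
  0 <= c -> c ^+ 2 + s ^+ 2 = 1 -> iid_normal X ->
  iid_normal (fun l w => plane_rotation i k c s (X ^~ w) l).
Proof.
move=> ik c0 cs1 [mX PX]; split=> [|B mB]; first exact: measurable_plane_rotation.
pose E := [set w | forall l, (l != i) && (l != k) -> B l (X l w)].
have mE : measurable E by exact: measurable_forall.
pose rot (z : R * R) := (c * z.1 + s * z.2, c * z.2 - s * z.1).
have mrot : measurable_fun setT rot.
  apply: measurable_fun_pair => //.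
    by apply: measurable_funD; apply: measurable_funM.
  by apply: measurable_funB; apply: measurable_funM.
pose RR := measurableTypeR R.
pose pr (w : Omega) : RR * RR := (X i w, X k w).
have mpr : measurable_fun setT pr by apply: measurable_fun_pair; exact: mX.
have [mu mu_pr] := exists_pushforward_measure (mrestr P mE) mpr.
pose C : \bar R := (\prod_(l | (l != i) && (l != k)) gauss (B l))%E.
have C0 : (0 <= C)%E by apply: prode_ge0 => l _.
have Cfin : C \is a fin_num.
  apply: prode_fin_num => l _; apply: fin_num_measure; exact: mB.
have fC0 : 0 <= fine C by exact: fine_ge0.
pose Cn : {nonneg R} := NngNum fC0.
have muE (A1 A2 : set RR) : measurable A1 -> measurable A2 ->
    mu (A1 `*` A2) = (Cn%:num%:E * gauss A1 * gauss A2)%E.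
  move=> mA1 mA2.
  (* Substituting [A1] and [A2] at [i] and [k] turns the measure of a rectangle into the probability
     of a box, to which the product formula for [X] applies. *)
  pose B' l := if l == i then A1 else if l == k then A2 else B l.
  have mB' l : measurable (B' l) by rewrite /B'; case: (l == i) => //;
    case: (l == k) => //; exact: mB.
  transitivity (P [set w | forall l, B' l (X l w)]).
    rewrite mu_pr; congr (P _); apply/seteqP; split=> w /=; rewrite /B'.
      move=> [[A1i A2k] Ew] l; case: eqP => [->//|/eqP li].
      by case: eqP => [->//|/eqP lk]; apply: Ew; rewrite li.
    move=> BX; split.
      by split; [have := BX i | have := BX k]; rewrite eqxx// eq_sym (negbTE ik).
    by move=> l /andP[li lk]; have := BX l; rewrite (negbTE li) (negbTE lk).
  rewrite PX// (bigD1 i)//= (bigD1 k) 1?eq_sym//= fineK//.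
  rewrite /B' eqxx eq_sym (negbTE ik) eqxx muleA muleC muleA; congr (_ * _ * _)%E.
  apply: eq_bigr => l /andP[li lk]; by rewrite (negbTE li) (negbTE lk).
have muE' (A : set (RR * RR)) : measurable A -> mu A = (C * (gauss \x gauss)%E A)%E.
  move=> mA; apply: etrans (mscale_product_measure_unique muE mA) _.
  by rewrite /= fineK.
have mBB : measurable (B i `*` B k) by exact: measurableX.
have mBB' : measurable (rot @^-1` (B i `*` B k)).
  by rewrite -[X in measurable X]setTI; exact: mrot.
transitivity (mu (rot @^-1` (B i `*` B k))).
  rewrite mu_pr; congr (P _); apply/seteqP; split=> w /=; rewrite /plane_rotation.
    move=> BX; split.
      have := BX k; rewrite eqxx eq_sym (negbTE ik) => Bk.
      by have := BX i; rewrite eqxx.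
    by move=> l /andP[li lk]; have := BX l; rewrite (negbTE li) (negbTE lk).
  move=> [[A1i A2k] Ew] l; case: eqP => [->//|/eqP li].
  by case: eqP => [->//|/eqP lk]; apply: Ew; rewrite li.
rewrite muE'// (product_normal_prob_rotation sigma_neq0 c0 cs1 mBB).
rewrite product_measure1E; [|exact: mB|exact: mB].
rewrite (bigD1 i)//=.
rewrite [X in _ = (_ * X)%E](bigD1 k) 1?eq_sym//=.
by rewrite muleC -muleA.
Qed.

Implicit Types (a : I -> I -> R) (i j k l : I).

Definition linear_image (a : I -> I -> R) (X : I -> Omega -> R) i w :=
  \sum_j a i j * X j w.

Definition preserves_iid_normal (a : I -> I -> R) :=
  forall X, iid_normal X -> iid_normal (linear_image a X).

(** Rotating both the rows and the sample leaves all inner products unchanged, so the rotated rows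
    send the rotated sample to the image of [X] under [a]. *)
Lemma preserves_iid_normal_rotation a i k c s : i != k ->
  0 <= c -> c ^+ 2 + s ^+ 2 = 1 ->
  preserves_iid_normal (fun l => plane_rotation i k c s (a l)) ->
  preserves_iid_normal a.
Proof.
move=> ik c0 cs1 Ga X /(iid_normal_plane_rotation ik c0 cs1)/Ga.
congr iid_normal; apply/funext => l; apply/funext => w.
exact: plane_rotation_dot.
Qed.

(** Each coordinate is only multiplied by [1] or [-1], and the centred normal law is symmetric. *)
Lemma preserves_iid_normal_diagonal a : orthogonal_family a ->
  (forall i, diagonal_row a i) -> preserves_iid_normal a.
Proof.
move=> oa da X [mX PX].
have aE : linear_image a X = fun i w => a i i * X i w.
  apply/funext => i; apply/funext => w; rewrite /linear_image (bigD1 i)//=.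
  by rewrite big1 ?addr0// => k ki; move/diagonal_rowP : (da i) => ->//; rewrite mul0r.
rewrite aE; split=> [i|B mB]; first by apply: measurable_funM.
have ma i : measurable_fun setT (fun x : R => a i i * x) by apply: measurable_funM.
have mB' i : measurable [set x | B i (a i i * x)].
  rewrite -[X in measurable X]setTI; exact: ma.
rewrite (PX _ mB'); apply: eq_bigr => i _.
have /eqP := diagonal_row_sqr oa (da i); rewrite sqrf_eq1 => /orP[] /eqP ->.
  by congr (normal_prob _ _ _); apply/seteqP; split=> x /=; rewrite mul1r.
rewrite -(normal_probN sigma_neq0 (mB i)).
by congr (normal_prob _ _ _); apply/seteqP; split=> x /=; rewrite mulN1r.
Qed.

(* One Givens rotation kills the entry [a i k], the sign being chosen so that its
   cosine is nonnegative. *)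
Lemma givens_rotation (x y : R) : y != 0 -> exists c s : R,
  [/\ 0 <= c, c ^+ 2 + s ^+ 2 = 1 & c * y - s * x = 0].
Proof.
move=> y0; pose r := Num.sqrt (x ^+ 2 + y ^+ 2).
have r2 : r ^+ 2 = x ^+ 2 + y ^+ 2 by rewrite sqr_sqrtr// addr_ge0// sqr_ge0.
have r0 : r != 0.
  rewrite -sqrf_eq0 r2 gt_eqF// ltr_wpDl// ?sqr_ge0//.
  by rewrite lt_def sqr_ge0 sqrf_eq0 y0.
pose e : R := if 0 <= x then 1 else -1.
have e2 : e ^+ 2 = 1 by rewrite /e; case: ifP; rewrite ?sqrrN expr1n.
exists (e * x / r), (e * y / r); split.
- rewrite divr_ge0 ?sqrtr_ge0// /e; case: ifPn => [|]; first by rewrite mul1r.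
  by rewrite -ltNge mulN1r oppr_ge0 => /ltW.
- rewrite !exprMn e2 !mul1r -mulrDl -r2 exprVn divff//.
  by rewrite sqrf_eq0.
- by rewrite mulrAC -mulrA mulrAC [X in _ - X]mulrAC; field.
Qed.

(** Each rotation kills one nonzero off-diagonal entry of row [i], and the induction runs on their
    number. The last hypothesis is a continuation: the family finally reached depends on the
    rotations chosen, and all that matters is that row [i] has become diagonal and no diagonal row
    has been lost. *)
Lemma preserves_iid_normal_clear_row n a i : orthogonal_family a ->
  (#|[pred k | (k != i) && (a i k != 0%R)]| <= n)%N ->
  (forall a', orthogonal_family a' -> diagonal_row a' i ->
    (forall j, diagonal_row a j -> diagonal_row a' j) ->
    preserves_iid_normal a') ->
  preserves_iid_normal a.
Proof.
elim: n a => [|n IHn] a oa.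
  rewrite leqn0 => /eqP/card0_eq a0 Ga; apply: Ga => //.
  apply/diagonal_rowP => k ki; apply/eqP.
  by have := a0 k; rewrite !inE ki => /negbFE.
move=> card_a Ga.
have [k|a0] := pickP [pred k | (k != i) && (a i k != 0)]; last first.
  by apply: IHn => //; rewrite (eq_card0 a0).
move=> /= /andP[ki aik0]; have ik : i != k by rewrite eq_sym.
have [c [s [c0 cs1 cs0]]] := givens_rotation (a i i) aik0.
apply: (preserves_iid_normal_rotation ik c0 cs1).
set a' := fun l => _.
have oa' : orthogonal_family a'.
  by move=> l m; rewrite /a' plane_rotation_dot.
have a'E l m : m != i -> m != k -> a' l m = a l m.
  by move=> mi mk; rewrite /a' /plane_rotation (negbTE mi) (negbTE mk).
have a'ik : a' i k = 0 by rewrite /a' /plane_rotation (negbTE ki) eqxx.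
(* A diagonal row [j] has zero entries in columns [i] and [k]: [a i k != 0] excludes [j = i], and it
   excludes [j = k] because the column of a diagonal row vanishes off the diagonal. The rotation
   therefore does not change such a row. *)
have fin_a' j : diagonal_row a j -> diagonal_row a' j.
  move=> dj.
  have ji : j != i.
    by apply: contraNneq aik0 => ji; move/diagonal_rowP : dj => dj; rewrite -ji dj// ji.
  have jk : j != k.
    by apply: contraNneq aik0 => jk; rewrite -jk (diagonal_row_column oa dj)// eq_sym.
  move/diagonal_rowP : dj => dj; apply/diagonal_rowP => l lj.
  rewrite /a' /plane_rotation !dj// 1?eq_sym//.
  by case: ifP => _; [|case: ifP => _]; rewrite ?mulr0 ?addr0 ?subr0.
apply: IHn => // [|b ob dbi db].
  (* Entry [k] becomes zero, entry [i] is not counted and the others do not change, so the count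
     drops strictly. *)
  rewrite -ltnS; apply: leq_trans card_a; apply: proper_card.
  apply/properP; split.
    apply/fintype.subsetP => l; rewrite !inE => /andP[li]; rewrite li /=.
    have [->|lk] := eqVneq l k; first by rewrite a'ik eqxx.
    by rewrite a'E.
  by exists k; rewrite !inE ?ki// a'ik eqxx andbF.
by apply: Ga => // j /fin_a'/db.
Qed.

(** Elimination row by row: the induction is on the number of rows not yet diagonal, which drops
    because clearing one row spoils no diagonal one. *)
Lemma preserves_iid_normal_orthogonal a :
  orthogonal_family a -> preserves_iid_normal a.
Proof.
move=> oa.
have [n] := ubnP #|[pred i | ~~ diagonal_row a i]|.
elim: n a oa => // n IHn a oa card_a.
have [i /= ndi|da] := pickP [pred i | ~~ diagonal_row a i]; last first.
  by apply: preserves_iid_normal_diagonal => // i; have /negbFE := da i.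
apply: (preserves_iid_normal_clear_row (i := i) oa (leqnn _)) => a' oa' da'i da'.
rewrite ltnS in card_a; apply: IHn => //; apply: leq_trans card_a.
apply: proper_card; apply/properP; split.
  by apply/fintype.subsetP => j; rewrite !inE; apply: contra => /da'.
by exists i; rewrite !inE ?ndi// da'i.
Qed.

End iid_normal.

(** * Real coordinates of complex matrices *)

Section cmatrix_part.
Context (R : realType) (m n : nat).
Local Notation I := ('I_m * 'I_n * bool)%type.

Definition complex_part (b : bool) (z : R[i]) : R :=
  if b then complex.Im z else complex.Re z.

Definition cmatrix_part (i : I) (A : cmatrix R m n) : R :=
  complex_part i.2 (cmatrix_entry i.1.1 i.1.2 A).

Lemma measurable_fun_cmatrix_partP d (T : measurableType d)
    (f : T -> cmatrix R m n) :
  measurable_fun setT f <->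
  forall i, measurable_fun setT (cmatrix_part i \o f).
Proof.
split=> [/measurable_fun_cmatrixP mf [[i j] b]|mf].
  by have /measurable_fun_complexP[? ?] := mf i j; case: b.
apply/measurable_fun_cmatrixP => i j; apply/measurable_fun_complexP.
by split; [exact: (mf (i, j, false)) | exact: (mf (i, j, true))].
Qed.

(** A pi-system in the real coordinates, matching the product formula of [iid_normal]. *)
Definition cmatrix_boxes : set (set (cmatrix R m n)) :=
  [set A | exists2 B : I -> set R, forall i, measurable (B i) &
    A = [set M | forall i, B i (cmatrix_part i M)]].

Lemma setI_closed_cmatrix_boxes : setI_closed cmatrix_boxes.
Proof.
move=> _ _ [B mB ->] [C mC ->]; exists (fun i => B i `&` C i).
  by move=> i; exact: measurableI.
apply/seteqP; split=> M /=; first by move=> [BM CM] i; split.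
by move=> BCM; split=> i; have [] := BCM i.
Qed.

Lemma setT_cmatrix_boxes : cmatrix_boxes setT.
Proof. by exists (fun=> setT) => //; apply/seteqP; split. Qed.

(** A box is a finite intersection of coordinate preimages. Conversely, a constraint on one
    coordinate is a box with [setT] elsewhere, so the identity out of the sigma-algebra of boxes is
    measurable. *)
Lemma measurable_cmatrixE :
  @measurable _ (cmatrix R m n) = <<s cmatrix_boxes >>.
Proof.
apply/seteqP; split; last first.
  apply: smallest_sub; first exact: sigma_algebra_measurable.
  move=> _ [B mB ->].
  have mid := (measurable_fun_cmatrix_partP idfun).1 (@measurable_id _ _ _).
  have -> : [set M | forall i, B i (cmatrix_part i M)] =
      \bigcap_(i in setT) (cmatrix_part i @^-1` B i).
    by apply/seteqP; split=> M /= BM i => [_|]; exact: BM.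
  apply: fin_bigcap_measurable => // i _.
  by rewrite -[X in measurable X]setTI; exact: mid.
pose T := g_sigma_algebraType cmatrix_boxes.
have : measurable_fun setT (idfun : T -> cmatrix R m n).
  apply/measurable_fun_cmatrix_partP => i _ B mB; rewrite setTI.
  apply: sub_sigma_algebra.
  exists (fun j => if j == i then B else setT).
    by move=> j; case: (j == i).
  apply/seteqP; split=> M /= => [BM j|/(_ i)]; last by rewrite eqxx.
  by case: eqP => // ->.
by move=> mid A mA; rewrite -(preimage_id A) -[X in _ X]setTI; exact: mid.
Qed.

End cmatrix_part.

(** * Laws of complex Gaussian matrices through their real coordinates *)

Section complex_normal_matrix.
Context d (Omega : measurableType d) (R : realType) (P : probability Omega R).
Variables (m n : nat).
Local Notation I := ('I_m * 'I_n * bool)%type.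

(** The boxes are a generating pi-system that contains the whole space, so they determine a finite
    measure. *)
Lemma eq_distribution_boxes (X Y : {RV P >-> cmatrix R m n}) :
  (forall B : I -> set R, (forall i, measurable (B i)) ->
    P [set w | forall i, B i (cmatrix_part i (X w))] =
    P [set w | forall i, B i (cmatrix_part i (Y w))]) ->
  eq_distribution P X Y.
Proof.
move=> PXY A mA.
apply: (measure_unique (@cmatrix_boxes R m n) (fun=> setT)) => //.
- exact: measurable_cmatrixE.
- exact: setI_closed_cmatrix_boxes.
- by move=> _; exact: setT_cmatrix_boxes.
- by rewrite bigcup_const//; exists 0%N.
- by move=> _ [B mB ->]; exact: PXY.
- by move=> _; rewrite fin_num_fun_lty//; exact: fin_num_measure.
Qed.

Lemma complex_normalM (v : R) (A B : set R) : measurable A -> measurable B ->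
  complex_normal v [set z | A (complex.Re z) /\ B (complex.Im z)] =
  (normal_prob 0 (Num.sqrt (v / 2)) A * normal_prob 0 (Num.sqrt (v / 2)) B)%E.
Proof. by move=> mA mB; rewrite -product_measure1E. Qed.

(** A box constrains each entry to a rectangle of real and imaginary parts; independence of the
    entries and then the product form of [complex_normal] factor its probability. *)
Lemma iid_complex_normal_parts (X : {RV P >-> cmatrix R m n}) v :
  iid_complex_normal P X v ->
  iid_normal P (Num.sqrt (v / 2)) (fun i : I => cmatrix_part i \o X).
Proof.
move=> [PX indX]; split=> [i|B mB].
  by apply: (measurable_fun_cmatrix_partP X).1; exact: measurable_funPT.
pose E (ij : 'I_m * 'I_n) : set R[i] :=
  [set z | B (ij, false) (complex.Re z) /\ B (ij, true) (complex.Im z)].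
have mE ij : measurable (E ij).
  exists (B (ij, false) `*` B (ij, true)); first exact: measurableX.
  by rewrite setTI.
pose F ij := (cmatrix_entry ij.1 ij.2 \o X) @^-1` E ij.
transitivity (P (\bigcap_(ij in [set j | j \in [set: 'I_m * 'I_n]%SET]) F ij)).
  congr (P _); apply/seteqP; split=> w /=.
    by move=> BX ij _; split; [exact: (BX (ij, false))|exact: (BX (ij, true))].
  move=> FX [ij b]; have /= [] := FX ij; first by rewrite inE.
  by case: b.
rewrite indX; last by move=> ij _; exists (E ij) => //; rewrite setTI.
pose g ij b := normal_prob 0 (Num.sqrt (v / 2)) (B (ij, b)).
transitivity (\prod_p g p.1 p.2)%E; last by apply: eq_bigr => -[].
rewrite -(pair_bigA _ g)/=.
under eq_bigl do rewrite inE.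
apply: eq_bigr => ij _; rewrite big_bool /= muleC -complex_normalM//.
exact: PX.
Qed.

End complex_normal_matrix.

(** * Unitary matrices as real orthogonal families *)

Section unitary_part.
Context (R : realType) (m n : nat).
Local Notation I := ('I_m * 'I_n * bool)%type.
Implicit Types (p q : I) (U : 'M[R[i]]_n).

Lemma complex_part_sum b (J : Type) (r : seq J) (F : J -> R[i]) :
  complex_part b (\sum_(j <- r) F j) = \sum_(j <- r) complex_part b (F j).
Proof. by apply: big_morph => [[? ?] [? ?]|]; case: b. Qed.

Lemma big_parts (F : I -> R) :
  \sum_q F q = \sum_i \sum_k (F (i, k, false) + F (i, k, true)).
Proof.
rewrite (pair_bigA _ (fun i k => F (i, k, false) + F (i, k, true)))/=.
transitivity (\sum_q F (q.1, q.2)); first by apply: eq_bigr => -[].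
rewrite -(pair_bigA _ (fun ik b => F (ik, b)))/=.
by apply: eq_bigr => -[i k] _; rewrite big_bool addrC.
Qed.

(* The real matrix of right multiplication by [U] on [m]-row complex matrices. *)
Definition unitary_part U p q : R :=
  (p.1.1 == q.1.1)%:R * complex_part p.2 ((if q.2 then 'i%C else 1) * U q.1.2 p.1.2).

(** Each [A i k] is a real combination of [1] and ['i], and row [i] of the product involves only row
    [i] of [A]. *)
Lemma cmatrix_part_mul U (A : 'M[R[i]]_(m, n)) p :
  cmatrix_part p (A *m U : cmatrix R m n) =
  \sum_q unitary_part U p q * cmatrix_part q (A : cmatrix R m n).
Proof.
case: p => [[i j] b]; rewrite big_parts (bigD1 i)//= [X in _ + X]big1 ?addr0; last first.
  move=> i' i'i; apply: big1 => k _.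
  by rewrite /unitary_part /= eq_sym (negbTE i'i) !mul0r addr0.
rewrite /cmatrix_part /cmatrix_entry /= mxE complex_part_sum.
apply: eq_bigr => k _; rewrite /unitary_part /= eqxx !mul1r.
by case: (A i k) (U k j) => [x y] [z t]; case: b => /=; ring.
Qed.

(** Rows with different [i] have disjoint supports. For equal [i], the inner product is the real
    part of the [(j, j')] entry of [U ^t* *m U] when [b = b'], and its imaginary part up to sign
    otherwise. *)
Lemma unitary_part_orthogonal U : U \is unitarymx ->
  orthogonal_family (unitary_part U).
Proof.
move=> uU [[i j] b] [[i' j'] b']; rewrite big_parts.
(* [unitarymx] gives orthonormal rows, while columns are needed here; the two agree because [U] is
   square. *)
have UU : U ^t* *m U = 1%:M by apply: mulmx1C; exact/unitarymxP.
have UUE c : \sum_k complex_part c (conjc (U k j) * U k j') =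
    complex_part c ((j == j')%:R : R[i]).
  have /matrixP/(_ j j') := UU; rewrite !mxE => <-.
  by rewrite complex_part_sum; apply: eq_bigr => k _; rewrite !mxE.
rewrite (bigD1 i)//= [X in _ + X]big1 ?addr0; last first.
  move=> i2 i2i; apply: big1 => k _.
  by rewrite /unitary_part /= eq_sym (negbTE i2i) !mul0r addr0.
have [ii'|ii'] := eqVneq i i'; last first.
  rewrite big1; last first.
    by move=> k _; rewrite /unitary_part /= (eq_sym i') (negbTE ii') !mul0r !mulr0 addr0.
  by case: eqP => // -[/eqP]; rewrite (negbTE ii').
rewrite -{i'}ii' !xpair_eqE eqxx /=.
transitivity (\sum_k (if b == b' then complex_part false (conjc (U k j) * U k j')
    else (-1) ^+ b * complex_part true (conjc (U k j) * U k j'))).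
  apply: eq_bigr => k _; rewrite /unitary_part /= !eqxx !mul1r.
  by case: (U k j) (U k j') => [x y] [z t]; case: b; case: b' => /=; ring.
have [_|_] := eqVneq b b'; first by rewrite UUE andbT; case: eqP.
by rewrite -mulr_sumr UUE andbF; case: eqP => _; rewrite mulr0.
Qed.

End unitary_part.

(** * Unitary invariance of complex Gaussian matrices *)

Section complex_normal_unitary.
Context d (Omega : measurableType d) (R : realType) (P : probability Omega R).
Variables (m n : nat).

Lemma eq_distribution_complex_normal_unitary (X : {RV P >-> cmatrix R m n})
    (v : R) (U : 'M[R[i]]_n) :
  0 < v -> iid_complex_normal P X v -> U \is unitarymx ->
  eq_distribution P (rmx_mul X (rmx_cst U) : {RV P >-> cmatrix R m n}) X.
Proof.
move=> v0 iX uU; apply: eq_distribution_boxes => B mB.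
have s0 : Num.sqrt (v / 2) != 0 by rewrite gt_eqF// sqrtr_gt0 divr_gt0.
have nX := iid_complex_normal_parts iX.
have nUX := preserves_iid_normal_orthogonal s0 (unitary_part_orthogonal uU) nX.
apply: etrans (esym (nX.2 B mB)); apply: etrans (nUX.2 B mB).
congr (P _); apply/seteqP; split=> w /= BX i.
  by rewrite /linear_image -cmatrix_part_mul; exact: BX.
by have := BX i; rewrite /linear_image -cmatrix_part_mul.
Qed.

End complex_normal_unitary.

(** * Relative entropy under maps with a measurable left inverse *)

Lemma measurable_lne (R : realType) : measurable_fun [set: \bar R] (fun x : \bar R => lne x).
Proof.
apply: (eq_measurable_fun (fun x : \bar R => if (x <= 0)%E then -oo%E else
    if (+oo <= x)%E then +oo%E else (ln (fine x))%:E)).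
  by move=> x _; case: x => [r| |] //=; rewrite leNye.
apply: (measurable_fun_ifT (f := fun x : \bar R => (x <= 0)%E)) => //.
  exact: measurable_fun_lee.
apply: (measurable_fun_ifT (f := fun x : \bar R => (+oo <= x)%E)) => //.
  exact: measurable_fun_lee.
apply/measurable_EFinP; apply: measurableT_comp; first exact: measurable_ln.
exact: fine_measurable.
Qed.

Section KL_divergence_injection.
Context d d' (S : measurableType d) (S' : measurableType d') (R : realType).
Variables (f : S -> S') (g : S' -> S).
Hypotheses (mf : measurable_fun setT f) (mg : measurable_fun setT g)
  (fK : cancel f g).

Let preimage_gK (A : set S) : f @^-1` (g @^-1` A) = A.
Proof. by apply/funext => x; rewrite /preimage /= fK. Qed.

Let measurable_preimage_f (A : set S') : measurable A -> measurable (f @^-1` A).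
Proof. by move=> mA; rewrite -[X in measurable X]setTI; exact: mf. Qed.

Let measurable_preimage_g (A : set S) : measurable A -> measurable (g @^-1` A).
Proof. by move=> mA; rewrite -[X in measurable X]setTI; exact: mg. Qed.

(** The positive and negative parts transfer separately, so [h] may have an infinite integral, as
    the logarithm of a density can. *)
Lemma integral_pushforwardT (p : {measure set S -> \bar R}) (h : S' -> \bar R) :
  measurable_fun setT h ->
  (\int[pushforward p f]_y h y = \int[p]_x h (f x))%E.
Proof.
move=> mh; have ge0 (k : S' -> \bar R) : measurable_fun setT k ->
    (forall y, 0 <= k y)%E ->
    (\int[pushforward p f]_y k y = \int[p]_x (k \o f) x)%E.
  by move=> mk k0; rewrite (ge0_integral_pushforward mf).
rewrite [LHS]integralE [RHS]integralE -/(h \o f) .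
rewrite (ge0 (h^\+)%E (measurable_funepos mh) (funepos_ge0 h)).
rewrite (ge0 (h^\-)%E (measurable_funeneg mh) (funeneg_ge0 h)).
by rewrite -(funepos_comp h f) -(funeneg_comp h f).
Qed.

(** Because of the left inverse [g], every measurable set of [S] is the preimage under [f] of a
    measurable set of [S']. Hence absolute continuity transfers both ways, and the density of [p']
    composed with [f] is a density of [p]. *)
Lemma KL_divergence_injection (p q : probability S R) (p' q' : probability S' R) :
  (forall A, measurable A -> p' A = p (f @^-1` A)) ->
  (forall A, measurable A -> q' A = q (f @^-1` A)) ->
  KL_divergence p q = KL_divergence p' q'.
Proof.
move=> p'E q'E; rewrite /KL_divergence.
have domE : p `<< q <-> p' `<< q'.
  split=> /null_content_dominatesP pq; apply/null_content_dominatesP => A mA.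
    move=> q'A0; rewrite p'E//; apply: pq; first exact: measurable_preimage_f.
    exact: etrans (esym (q'E _ mA)) q'A0.
  move=> qA0; rewrite -(preimage_gK A) -p'E; last exact: measurable_preimage_g.
  apply: pq; first exact: measurable_preimage_g.
  apply: etrans (q'E _ (measurable_preimage_g mA)) _.
  by rewrite preimage_gK.
case: asboolP => [pq|npq]; last first.
  by case: asboolP => [/domE|].
case: asboolP => [p'q'|/domE//].
set r := Radon_Nikodym _ q; set r' := Radon_Nikodym _ q'.
have ir : q.-integrable setT r by exact: Radon_Nikodym_integrable.
have ir' : q'.-integrable setT r' by exact: Radon_Nikodym_integrable.
have mr' : measurable_fun setT r' by exact: measurable_int ir'.
have mr'f : measurable_fun setT (r' \o f) by exact: measurableT_comp.
have ir'f : q.-integrable setT (r' \o f).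
  apply/integrableP; split=> //.
  move/integrableP : ir' => [_]; apply: le_lt_trans.
  rewrite (eq_measure_integral (pushforward q f)); last first.
    by move=> A mA _; exact: q'E.
  by rewrite integral_pushforwardT//; exact: measurableT_comp.
(* Writing [E] as the preimage under [f] of its preimage under [g] shows that both functions
   integrate to [p E] over [E]. *)
have rE : ae_eq q setT r (r' \o f).
  apply: integral_ae_eq => // E _ mE.
  have mgE := measurable_preimage_g mE.
  have rint := Radon_Nikodym_integral (nu := charge_of_finite_measure p) pq mE.
  have r'int := Radon_Nikodym_integral (nu := charge_of_finite_measure p')
    p'q' mgE.
  rewrite -rint -[LHS]/(p E) -[in LHS](preimage_gK E) -p'E//.
  rewrite -[LHS]/(charge_of_finite_measure p' (g @^-1` E)) r'int.
  rewrite (eq_measure_integral (pushforward q f)); last first.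
    by move=> A mA _; exact: q'E.
  rewrite integral_pushforward// preimage_gK//.
  by apply: integrableS ir'f.
transitivity (\int[p]_x lne (r' (f x)))%E.
  apply: ae_eq_integral => //.
  - apply: measurableT_comp; first exact: measurable_lne.
    exact: measurable_int ir.
  - by apply: measurableT_comp; first exact: measurable_lne.
  (* The densities agree almost everywhere for [q], whereas the entropy integrates against [p];
     absolute continuity bridges the two. *)
  - apply: (null_dominates_ae_eq _ pq) => //.
    by apply: filterS rE => x /= + _ => ->.
rewrite (eq_measure_integral (pushforward p f)); last first.
  by move=> A mA _; exact: p'E.
rewrite integral_pushforwardT//.
by apply: measurableT_comp; first exact: measurable_lne.
Qed.

End KL_divergence_injection.

(** * Joint laws of independent random elements *)

Section joint_distribution.
Context d (Omega : measurableType d) (R : realType) (P : probability Omega R).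

Lemma eq_measure_rectangles d1 d2 (T1 : measurableType d1)
    (T2 : measurableType d2) (m1 m2 : {measure set (T1 * T2) -> \bar R}) :
  (m1 setT < +oo)%E ->
  (forall A B, measurable A -> measurable B -> m1 (A `*` B) = m2 (A `*` B)) ->
  forall C, measurable C -> m1 C = m2 C.
Proof.
move=> m1oo m12 C mC.
pose G := [set A `*` B | A in @measurable _ T1 & B in @measurable _ T2].
apply: (measure_unique G (fun=> setT)) => //.
- exact: measurable_prod_measurableType.
- move=> _ _ [A mA [B mB <-]] [A' mA' [B' mB' <-]]; rewrite -setXI.
  by exists (A `&` A'); [exact: measurableI|exists (B `&` B') => //; exact: measurableI].
- by move=> _; exists setT => //; exists setT => //; rewrite setXTT.
- by rewrite bigcup_const//; exists 0%N.
- by move=> _ [A mA [B mB <-]]; exact: m12.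
Qed.

Lemma eq_distribution_rv_pair d1 d2 (S1 : measurableType d1)
    (S2 : measurableType d2) (X X' : {RV P >-> S1}) (Y Y' : {RV P >-> S2}) :
  (forall A B, measurable A -> measurable B ->
    P (X @^-1` A `&` Y @^-1` B) = P (X' @^-1` A `&` Y' @^-1` B)) ->
  eq_distribution P (rv_pair P X Y : {RV P >-> (S1 * S2)%type}) (rv_pair P X' Y').
Proof.
move=> PXY A mA; apply: eq_measure_rectangles mA => //.
  by rewrite fin_num_fun_lty//; exact: fin_num_measure.
Qed.

Context d1 d2 d3 (S1 : measurableType d1) (S2 : measurableType d2)
  (S3 : measurableType d3).

Lemma mutually_independent_triple (X : {RV P >-> S1}) (Y : {RV P >-> S2})
    (Z : {RV P >-> S3}) :
  mutually_independent P (tnth [tuple g_sigma_algebra_preimage X;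
    g_sigma_algebra_preimage Y; g_sigma_algebra_preimage Z]) ->
  forall A B C, measurable A -> measurable B -> measurable C ->
  P (X @^-1` A `&` (Y @^-1` B `&` Z @^-1` C)) =
  (P (X @^-1` A) * (P (Y @^-1` B) * P (Z @^-1` C)))%E.
Proof.
move=> ind A B C mA mB mC.
pose E := tnth [tuple X @^-1` A; Y @^-1` B; Z @^-1` C].
have preimageE d' (S : measurableType d') (V : {RV P >-> S}) D :
    measurable D -> g_sigma_algebra_preimage V (V @^-1` D).
  by move=> mD; exists D => //; rewrite setTI.
have indE := ind [set: 'I_3]%SET E.
transitivity (P (\bigcap_(i in [set j | j \in [set: 'I_3]%SET]) E i)).
  congr (P _); apply/seteqP; split=> w /=.
    by move=> [Aw [Bw Cw]] [[|[|[|//]]] ?] _ /=; rewrite /E /tnth /=.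
  move=> EE; have Ew i : E i w by apply: EE; rewrite /= inE.
  split; first exact: (Ew (@Ordinal 3 0 isT)).
  by split; [exact: (Ew (@Ordinal 3 1 isT))|exact: (Ew (@Ordinal 3 2 isT))].
rewrite indE; last by move=> [[|[|[|//]]] ?] _ /=; rewrite /E /tnth /=; exact: preimageE.
under eq_bigl do rewrite inE.
by rewrite !big_ord_recl big_ord0 mule1 /E.
Qed.

(** As a function of [X], the element [X'] inherits the independence from [Y] and [Z], so both
    triples obey the same product formula. Uniqueness on rectangles is used twice: for the outer
    pair, then, with the first event fixed, for the law of [(Y, Z)]. *)
Lemma eq_distribution_triple (X X' : {RV P >-> S1}) (Y : {RV P >-> S2})
    (Z : {RV P >-> S3}) (f : S1 -> S1) : measurable_fun setT f ->
  (forall w, X' w = f (X w)) -> eq_distribution P X' X ->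
  mutually_independent P (tnth [tuple g_sigma_algebra_preimage X;
    g_sigma_algebra_preimage Y; g_sigma_algebra_preimage Z]) ->
  eq_distribution P (rv_pair P X' (rv_pair P Y Z) : {RV P >-> (S1 * (S2 * S3))%type})
    (rv_pair P X (rv_pair P Y Z)).
Proof.
move=> mf X'E X'X ind; apply: eq_distribution_rv_pair => A D mA mD.
have mpre d' (S : measurableType d') (V : {RV P >-> S}) B :
    measurable B -> measurable (V @^-1` B).
  by move=> mB; rewrite -[X in measurable X]setTI; exact: measurable_funPT.
have mfA : measurable (f @^-1` A).
  by rewrite -[X in measurable X]setTI; exact: mf.
have X'preE : X' @^-1` A = X @^-1` (f @^-1` A).
  by apply/seteqP; split=> w /=; rewrite X'E.
have mYZ := measurable_funPT (rv_pair P Y Z).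
have [mu muE] := exists_pushforward_measure (mrestr P (mpre _ _ X' _ mA)) mYZ.
have [nu nuE] := exists_pushforward_measure (mrestr P (mpre _ _ X _ mA)) mYZ.
transitivity (mu D); first by rewrite muE /mrestr setIC.
transitivity (nu D); last by rewrite nuE /mrestr setIC.
apply: eq_measure_rectangles mD.
  by rewrite muE fin_num_fun_lty//; apply: fin_num_measure; apply: measurableI => //; exact: mpre.
move=> B C mB mC; rewrite muE nuE /mrestr.
have preE V : rv_pair P Y Z @^-1` (B `*` C) `&` V =
    V `&` (Y @^-1` B `&` Z @^-1` C) by rewrite setIC.
apply: etrans (congr1 P (preE _)) _.
apply: etrans (esym (congr1 P (preE _))).
rewrite X'preE !(mutually_independent_triple ind)//.
by congr (_ * _)%E; rewrite -X'preE; exact: X'X.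
Qed.

End joint_distribution.

(** * Matrix operations on unbundled measurable functions *)

Section measurable_cmatrix_operations.
Context d (T : measurableType d) (R : realType).

Lemma measurable_cmatrixM m n p (f : T -> cmatrix R m n) (g : T -> cmatrix R n p) :
  measurable_fun setT f -> measurable_fun setT g ->
  measurable_fun setT (fun x => (f x *m g x : 'M[R[i]]_(m, p)) : cmatrix R m p).
Proof.
move=> mf mg.
pose f_mixin := isMeasurableFun.Build _ _ _ _ _ mf.
pose g_mixin := isMeasurableFun.Build _ _ _ _ _ mg.
pose F : {mfun T >-> cmatrix R m n} := HB.pack f f_mixin.
pose G : {mfun T >-> cmatrix R n p} := HB.pack g g_mixin.
exact: (measurable_rmx_mul F G).
Qed.

Lemma measurable_cmatrixD m n (f g : T -> cmatrix R m n) :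
  measurable_fun setT f -> measurable_fun setT g ->
  measurable_fun setT
    (fun x => ((f x : 'M[R[i]]_(m, n)) + (g x : 'M[R[i]]_(m, n))) : cmatrix R m n).
Proof.
move=> mf mg.
pose f_mixin := isMeasurableFun.Build _ _ _ _ _ mf.
pose g_mixin := isMeasurableFun.Build _ _ _ _ _ mg.
pose F : {mfun T >-> cmatrix R m n} := HB.pack f f_mixin.
pose G : {mfun T >-> cmatrix R m n} := HB.pack g g_mixin.
exact: (measurable_rmx_add F G).
Qed.

Lemma measurable_cmatrixZ m n (c : R[i]) (f : T -> cmatrix R m n) :
  measurable_fun setT f ->
  measurable_fun setT (fun x => (c *: (f x : 'M[R[i]]_(m, n))) : cmatrix R m n).
Proof.
move=> mf; pose f_mixin := isMeasurableFun.Build _ _ _ _ _ mf.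
pose F : {mfun T >-> cmatrix R m n} := HB.pack f f_mixin.
exact: (measurable_rmx_scale c F).
Qed.

End measurable_cmatrix_operations.

Lemma eq_distribution_comp d (Omega : measurableType d) (R : realType)
    (P : probability Omega R) d1 d2 (S1 : measurableType d1)
    (S2 : measurableType d2) (f : S1 -> S2)
    (X X' : {RV P >-> S1}) (Y Y' : {RV P >-> S2}) : measurable_fun setT f ->
  (forall w, Y w = f (X w)) -> (forall w, Y' w = f (X' w)) ->
  eq_distribution P X X' -> eq_distribution P Y Y'.
Proof.
move=> mf YE Y'E XX' A mA.
have mfA : measurable (f @^-1` A).
  by rewrite -[X in measurable X]setTI; exact: mf.
have := XX' _ mfA; rewrite /distribution /pushforward.
have -> : Y @^-1` A = X @^-1` (f @^-1` A).
  by apply/seteqP; split=> w /=; rewrite YE.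
have -> // : Y' @^-1` A = X' @^-1` (f @^-1` A).
by apply/seteqP; split=> w /=; rewrite Y'E.
Qed.

(** * Mutual information under an injective recoding of the input *)

Section mutual_information_injection.
Context d (Omega : measurableType d) (R : realType) (P : probability Omega R).
Context d1 d1' d2 (S1 : measurableType d1) (S1' : measurableType d1')
  (S2 : measurableType d2).
Variables (h : S1 -> S1') (k : S1' -> S1).
Hypotheses (mh : measurable_fun setT h) (mk : measurable_fun setT k)
  (hK : cancel h k).

(** The joint law determines the marginals, through rectangles with one side [setT]. By uniqueness
    on rectangles the product of the new marginals is the pushforward of the old product, so both
    arguments of the relative entropy move along the same map. *)
Lemma mutual_information_injection (X : {RV P >-> S1}) (X' : {RV P >-> S1'})
    (Y Y' : {RV P >-> S2}) :
  (forall A, measurable A -> distribution P (rv_pair P X' Y') A =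
    distribution P (rv_pair P X Y) ((fun z => (h z.1, z.2)) @^-1` A)) ->
  mutual_information P X' Y' = mutual_information P X Y.
Proof.
move=> XYE; pose f z := (h z.1, z.2 : S2); pose g z := (k z.1, z.2 : S2).
have mf : measurable_fun setT f.
  by apply: measurable_fun_pair => //; apply: measurableT_comp.
have mg : measurable_fun setT g.
  by apply: measurable_fun_pair => //; apply: measurableT_comp.
have fK : cancel f g by move=> [x y]; rewrite /f /g /= hK.
have XE B : measurable B -> distribution P X' B = distribution P X (h @^-1` B).
  move=> mB; have := XYE (B `*` setT) (measurableX mB measurableT).
  congr (P _ = P _); apply/funext => w; apply/propext.
    by split=> [[]|].
  by split=> [[]|].
have YE C : measurable C -> distribution P Y' C = distribution P Y C.
  move=> mC; have := XYE (setT `*` C) (measurableX measurableT mC).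
  congr (P _ = P _); apply/funext => w; apply/propext.
    by split=> [[]|].
  by split=> [[]|].
apply/esym/(KL_divergence_injection mf mg fK) => // A mA.
have [mu muE] := exists_pushforward_measure
  (distribution P X \x distribution P Y)%E mf.
rewrite -muE; apply: product_measure_unique mA => B C mB mC.
have mhB : measurable (h @^-1` B).
  by rewrite -[X in measurable X]setTI; exact: mh.
rewrite muE; apply: etrans (product_measure1E _ _ mhB mC) _.
by congr (_ * _)%E; [exact/esym/XE | exact/esym/YE].
Qed.

End mutual_information_injection.

Theorem mainTheorem2 (R : realType) (M T Nc Ns : nat)
  (M_gt0 : (0 < M)%N) (le_MT : (M <= T)%N) (Nc_gt0 : (0 < Nc)%N)
  (Ns_gt0 : (0 < Ns)%N)
  (sigma_c sigma_s : R)
  (sigma_c_gt0 : 0 < sigma_c ^+ 2) (sigma_s_gt0 : 0 < sigma_s ^+ 2)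
  (Rs Us : 'M[R[i]]_M) (lambda : 'I_M -> R)
  (Rs_posdef : posdefmx Rs)
  (Us_unitary : Us \is unitarymx)
  (Rs_eigen : Rs = Us *m real_diag_mx lambda *m Us ^t*)
  (lambda_gt0 : forall i, 0 < lambda i)
  (kappa : R) (kappaE : kappa = (sigma_s ^+ 2 * Ns%:R)^-1)
  (nu : R) (nu_ge0 : 0 <= nu)
  (ds : 'I_M -> R)
  (ds_ge0 : forall i, 0 <= ds i)
  (dsE : forall i,
     ds i ^+ 2 = (kappa * T%:R)^-1 * Num.max (nu - (lambda i)^-1) 0)
  (ds_power : \sum_(i < M) ds i ^+ 2 = M%:R)
  (d : measure_display) (Omega : measurableType d) (P : probability Omega R)
  (Hc : {RV P >-> cmatrix R Nc M}) (Zc : {RV P >-> cmatrix R Nc T})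
  (Q : {RV P >-> cmatrix R M T})
  (Hc_normal : iid_complex_normal P Hc 1)
  (Zc_normal : iid_complex_normal P Zc (sigma_c ^+ 2))
  (Q_semi_unitary : semi_unitary P Q)
  (Q_isotropic : isotropic P Q)
  (indep : mutually_independent P (tnth [tuple g_sigma_algebra_preimage Hc;
     g_sigma_algebra_preimage Zc; g_sigma_algebra_preimage Q])) :
  let sqrtT : R[i] := (Num.sqrt T%:R)%:C in
  let Ds : 'M[R[i]]_M := real_diag_mx ds in
  let Xs : {RV P >-> cmatrix R M T} :=
    rmx_scale sqrtT (rmx_mul (rmx_cst (Us *m Ds)) Q) in
  let Xeff : {RV P >-> cmatrix R M T} :=
    rmx_scale sqrtT (rmx_mul (rmx_cst Ds) Q) in
  eq_distribution P (rmx_mul Hc Xs)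
    (rmx_scale sqrtT (rmx_mul (rmx_mul Hc (rmx_cst Ds)) Q)) /\
  mutual_information P Xs (rmx_add (rmx_mul Hc Xs) Zc) =
  mutual_information P Xeff (rmx_add (rmx_mul Hc Xeff) Zc).

Proof.
move=> sqrtT Ds Xs Xeff.
pose HU : {RV P >-> cmatrix R Nc M} := rmx_mul Hc (rmx_cst Us).
pose ZQ : {RV P >-> (cmatrix R Nc T * cmatrix R M T)%type} := rv_pair P Zc Q.
pose S := (cmatrix R Nc M * (cmatrix R Nc T * cmatrix R M T))%type.
pose J : {RV P >-> S} := rv_pair P Hc ZQ.
pose J' : {RV P >-> S} := rv_pair P HU ZQ.
have J'J : eq_distribution P J' J.
  apply: (eq_distribution_triple (f := fun A : cmatrix R Nc M =>
    (A *m Us : 'M[R[i]]_(Nc, M)) : cmatrix R Nc M)) => //.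
    by apply: measurable_cmatrixM => //; exact: measurable_cst.
  exact: eq_distribution_complex_normal_unitary Hc_normal Us_unitary.
have m1 : measurable_fun setT (fun s : S => s.1) by exact: measurable_fst.
have m21 : measurable_fun setT (fun s : S => s.2.1).
  by apply: measurableT_comp; [exact: measurable_fst|exact: measurable_snd].
have m22 : measurable_fun setT (fun s : S => s.2.2).
  by apply: measurableT_comp; [exact: measurable_snd|exact: measurable_snd].
(* [xeff] and [yeff] read the effective input and output off a sample [s] of channel, noise and [Q],
   in this order. They can thus be evaluated on [J] as well as on [J']. *)
pose xeff (s : S) : cmatrix R M T := sqrtT *: (Ds *m s.2.2 : 'M[R[i]]_(M, T)).
have mxeff : measurable_fun setT xeff.
  by apply: measurable_cmatrixZ; apply: measurable_cmatrixM => //; exact: measurable_cst.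
pose yeff (s : S) : cmatrix R Nc T := (s.1 *m xeff s : 'M[R[i]]_(Nc, T)) + s.2.1.
have myeff : measurable_fun setT yeff.
  by apply: measurable_cmatrixD => //; exact: measurable_cmatrixM.
have XsE w : Xs w = (Us *m Xeff w : 'M[R[i]]_(M, T)).
  by rewrite /Xs /Xeff /= /rmx_scale /rmx_mul /rmx_cst -scalemxAr mulmxA.
split.
  (* Both sides are the same function, of [J'] on the left and of [J] on the right. *)
  apply: (eq_distribution_comp (f := fun s : S =>
    (sqrtT *: (s.1 *m Ds *m s.2.2 : 'M[R[i]]_(Nc, T))) : cmatrix R Nc T) _ _ _ J'J) => //.
  - apply: measurable_cmatrixZ; apply: measurable_cmatrixM => //.
    by apply: measurable_cmatrixM => //; exact: measurable_cst.
  - by move=> w; rewrite /= /rmx_mul /rmx_scale /rmx_mul /rmx_cst /= -scalemxAr !mulmxA.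
pose f (xy : cmatrix R M T * cmatrix R Nc T) : cmatrix R M T * cmatrix R Nc T :=
  (Us *m xy.1 : 'M[R[i]]_(M, T), xy.2).
have mleft (A : 'M[R[i]]_M) : measurable_fun setT
    (fun x : cmatrix R M T => (A *m x : 'M[R[i]]_(M, T)) : cmatrix R M T).
  by apply: measurable_cmatrixM => //; exact: measurable_cst.
have mf : measurable_fun setT f.
  by apply: measurable_fun_pair => //; apply: measurableT_comp => //; exact: mleft.
have UsK : cancel (fun x : cmatrix R M T => (Us *m x : 'M[R[i]]_(M, T)) : cmatrix R M T)
    (fun x : cmatrix R M T => (Us ^t* *m x : 'M[R[i]]_(M, T)) : cmatrix R M T).
  have UU : Us ^t* *m Us = 1%:M by apply: mulmx1C; exact/unitarymxP.
  by move=> x; rewrite mulmxA UU mul1mx.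
pose Yeff : {RV P >-> cmatrix R Nc T} := rmx_add (rmx_mul Hc Xeff) Zc.
pose Ys : {RV P >-> cmatrix R Nc T} := rmx_add (rmx_mul Hc Xs) Zc.
(* By associativity [Us] moves from the input to the channel: the actual output is the effective one
   for the channel [HU]. *)
have YsE w : Ys w = yeff (J' w).
  transitivity ((Hc w *m Xs w : 'M[R[i]]_(Nc, T)) + (Zc w : 'M[R[i]]_(Nc, T))).
    by [].
  by rewrite XsE mulmxA.
have mpair : measurable_fun setT (fun s : S => f (xeff s, yeff s)).
  by apply: measurableT_comp; [exact: mf|exact: measurable_fun_pair].
(* [(Xs, Ys)] is the image of [J'] under a map that sends [J] to [(Us *m Xeff, Yeff)], so equality
   of the laws of [J'] and [J] suffices. *)
have pairE A : measurable A ->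
    distribution P (rv_pair P Xs Ys) A = distribution P (rv_pair P Xeff Yeff) (f @^-1` A).
  move=> mA; pose D := (fun s : S => f (xeff s, yeff s)) @^-1` A.
  have mD : measurable D by rewrite -[X in measurable X]setTI; exact: mpair.
  apply: etrans (J'J D mD); apply: (congr1 P); apply/funext => w.
  by apply: (congr1 A); rewrite -[LHS]/(Xs w, Ys w) XsE YsE.
exact: (mutual_information_injection (X := Xeff) (X' := Xs) (Y := Yeff)
  (Y' := Ys) (mleft Us) (mleft (Us ^t*)) UsK pairE).
Qed.
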